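(* Consider the best arm identification task with $K\ge2$ arms having Gaussian distributions with variance $1$. For any class $\mathcal C$ of algorithm families containing the static proportions algorithms ($\mathcal C^{sp}\subseteq\mathcal C$), $$\inf_{\mathcal A\in\mathcal C_\infty}\ \sup_{\lambda\in\mathcal D}R_{H_{\mathcal C},\infty}(\mathcal A,\lambda)\ge\frac{3}{80}\log(K).$$
   Context: Setting (fixed budget best arm identification, Gaussian arms). There are $K$ arms; arm $k\in[K]$ has distribution $\mathcal N(\mu_k,1)$ with unknown mean $\mu_k\in\mathbb R$. A bandit problem is identified with its mean vector $\mu\in\mathbb R^K$. $\mathcal D$ is the set of all $\mu\in\mathbb R^K$ with a unique largest coordinate, $\mathcal I=[K]$, and $i^\star(\mu)=\arg\max_k\mu_k$; $i^\star$ is extended with arbitrary values in $\mathcal I$ to all of $\mathbb R^K$. $\mathrm{Alt}(\mu)=\{\lambda\in\mathcal D:i^\star(\lambda)\ne i^\star(\mu)\}$, and $\mathrm{KL}(x,y)=(x-y)^2/2$. An algorithm with horizon $T$: at each time $t=1,\dots,T$ it chooses an arm $k_t$ based on the previous observations and observes an independent sample from the distribution of arm $k_t$; after time $T$ it returns an answer $\hat i_T\in\mathcal I$ based on the observations. $N_{T,k}$ is the number of samples of arm $k$ up to time $T$ and $\hat\mu_{T,k}$ is their average. The error probability on problem $\mu$ is $p_{\mu,T}(\mathcal A)=\mathbb P_{\mu,\mathcal A}(\hat i_T\ne i^\star(\mu))$. An algorithm family is a sequence $\mathcal A=(\mathcal A_T)_{T\ge1}$ of algorithms, one for each horizon $T$;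 a class is a set of algorithm families; $\mathcal C_\infty$ is the class of all algorithm families. Let $h_{\mu,T}(\mathcal A)=T/\log(1/p_{\mu,T}(\mathcal A))\in[0,\infty]$ ($=0$ if $p_{\mu,T}=0$, $=\infty$ if $p_{\mu,T}=1$). The oracle difficulty of a class $\mathcal C$ is $H_{\mathcal C}(\mu)=\inf_{\mathcal A\in\mathcal C}\limsup_{T\to\infty}h_{\mu,T}(\mathcal A)$. Static proportions: let $\triangle_K^0=\{\omega\in\triangle_K:\omega_k>0\ \forall k\}$, with $\triangle_K$ the probability simplex. A static proportions algorithm family parametrized by $\omega\in\triangle_K^0$ is one whose sampling rule satisfies $|N_{T,k}-T\omega_k|\le K$ for all $T$ and all $k\in[K]$, and which returns $\hat i_T=i^\star(\hat\mu_T)$. $\mathcal C^{sp}$ is the class of all of these, for all $\omega\in\triangle_K^0$; its oracle difficulty equals $H_{\mathcal C^{sp}}(\mu)=\big(\sup_{\omega\in\triangle_K^0}\inf_{\lambda\in\mathrm{Alt}(\mu)}\sum_{k}\omega_k\mathrm{KL}(\lambda_k,\mu_k)\big)^{-1}$. Difficulty ratio with respect to $H:\mathcal D\to\mathbb R^+$: $R_{H,T}(\mathcal A,\mu)=h_{\mu,T}(\mathcal A)/H(\mu)=\dfrac{T}{H(\mu)\log(1/p_{\mu,T}(\mathcal A))}\in[0,\infty]$ (equal to $+\infty$ if $H(\mu)=0$), and $R_{H,\infty}(\mathcal A,\mu)=\limsup_{T\to\infty}R_{H,T}(\mathcal A,\mu)$. *)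

(* Defs.v *)
From HB Require Import structures.
From mathcomp Require Import all_boot all_order all_algebra.
From mathcomp Require Import all_classical all_reals all_analysis measurable_realfun.

Set Implicit Arguments.
Unset Strict Implicit.
Unset Printing Implicit Defensive.

Import Order.TTheory GRing.Theory Num.Theory numFieldNormedType.Exports.
Local Open Scope classical_set_scope.
Local Open Scope ring_scope.

Section observation_step.
Context {R : realType} {K t : nat}.
Variables (mu : K.-tuple R) (P : probability (t.-tuple R) R).
Variables (a : t.-tuple R -> 'I_K) (ma : forall k, measurable (a @^-1` [set k])).

(* If P is the law of the first t observations, then this is the law of the
   first t + 1 of them, when the last one is sampled from N(mu_k, 1) for
   k = a h, conditionally on the history h. *)
Definition observe (_ : forall k, measurable (a @^-1` [set k]))
    (E : set (t.+1.-tuple R)) : \bar R :=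
  (\int[P]_h normal_prob (tnth mu (a h)) 1
     [set y | E [tuple of rcons h y]])%E.

Let measurable_rcons : measurable_fun [set: t.-tuple R * R]
  (fun hy => [tuple of rcons hy.1 hy.2] : t.+1.-tuple R).
Proof.
apply/measurable_fun_tnthP => i.
have [it|ti] := ltnP i t.
  rewrite (_ : _ \o _ = (fun hy : t.-tuple R * R => tnth hy.1 (Ordinal it))).
    apply: (measurableT_comp (measurable_tnth (Ordinal it))).
    exact: measurable_fst.
  apply/funext => -[h y] /=.
  by rewrite (tnth_nth 0) /= nth_rcons size_tuple it (tnth_nth 0).
rewrite (_ : _ \o _ = (fun hy : t.-tuple R * R => hy.2)).
  exact: measurable_snd.
apply/funext => -[h y] /=.
have -> : i = ord_max by apply/val_inj/anti_leq; rewrite ti -ltnS ltn_ord.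
by rewrite (tnth_nth 0) /= nth_rcons size_tuple ltnn eqxx.
Qed.

Let slice (E : set (t.+1.-tuple R)) (h : t.-tuple R) : set R :=
  [set y | E [tuple of rcons h y]].

Let sliceE E h : slice E h =
  xsection ((fun hy : t.-tuple R * R => [tuple of rcons hy.1 hy.2]) @^-1` E) h.
Proof. by rewrite xsectionE. Qed.

Let measurable_slice E h : measurable E -> measurable (slice E h).
Proof.
move=> mE; rewrite sliceE; apply: measurable_xsection.
by rewrite -[X in measurable X]setTI; exact: measurable_rcons.
Qed.

Let measurable_observe_fun E : measurable E ->
  measurable_fun [set: t.-tuple R]
    (fun h => normal_prob (tnth mu (a h)) 1 (slice E h)).
Proof.
move=> mE.
rewrite (_ : (fun h => _) = (fun h => \sum_(k < K)
    ((\1_(a @^-1` [set k]) h)%:E * normal_prob (tnth mu k) 1 (slice E h))%E)%E).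
  apply: emeasurable_sum => k; apply: emeasurable_funM.
    by apply/measurable_EFinP; exact: measurable_indic.
  rewrite (_ : (fun h => _) = normal_prob (tnth mu k) 1 \o xsection
      ((fun hy : t.-tuple R * R => [tuple of rcons hy.1 hy.2]) @^-1` E)).
    apply: (@measurable_fun_xsection _ _ _ _ _ (normal_prob (tnth mu k) 1)).
    by rewrite -[X in measurable X]setTI; exact: measurable_rcons.
  by apply/funext => h /=; rewrite -sliceE.
apply/funext => h; rewrite (bigD1 (a h))//= indicE mem_set//= mul1e.
rewrite big1 ?adde0// => k kah.
by rewrite indicE memNset ?mul0e//= => ahk; rewrite ahk eqxx in kah.
Qed.

Let observe0 : observe ma set0 = 0%E.
Proof. by apply: integral0_eq => h _; rewrite -/(slice _ _) measure0. Qed.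

Let observe_ge0 E : (0 <= observe ma E)%E.
Proof. by apply: integral_ge0 => h _; exact: measure_ge0. Qed.

Let observe_sigma_additive : semi_sigma_additive (observe ma).
Proof.
move=> F mF tF mUF.
rewrite [X in _ --> X](_ : _ =
    (\sum_(0 <= i <oo) observe ma (F i))%E).
  by apply: is_cvg_ereal_nneg_natsum_cond => n _ _; exact: observe_ge0.
rewrite /observe -integral_nneseries//.
- apply: eq_integral => h _.
  rewrite (_ : [set y | _] = \bigcup_n slice (F n) h)//.
  apply/esym/cvg_lim => //.
  apply: measure_semi_sigma_additive.
  + by move=> i; exact: measurable_slice.
  + apply/trivIsetP => i j _ _ ij; move/trivIsetP: tF => /(_ i j I I ij) Fij.
    apply/seteqP; split => // y [Fi Fj].
    suff : (F i `&` F j) [tuple of rcons h y] by rewrite Fij.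
    by split.
  + by apply: bigcup_measurable => i _; exact: measurable_slice.
- by move=> n; exact: measurable_observe_fun.
Qed.

HB.instance Definition _ := isMeasure.Build _ _ _ (observe ma)
  observe0 observe_ge0 observe_sigma_additive.

Let observe_setT : observe ma setT = 1%E.
Proof.
rewrite /observe -[RHS](@probability_setT _ _ _ P).
by rewrite -[RHS]mul1e -integral_cst//; apply: eq_integral => h _;
  exact: probability_setT.
Qed.

HB.instance Definition _ :=
  @Measure_isProbability.Build _ _ R (observe ma) observe_setT.

End observation_step.

Section algorithms.
Context {R : realType} {K : nat}.

(* Rounds are numbered from 0: [rule t] maps the first t observations to the
   arm pulled next.  Since the arms are functions of the past observations, a
   history only has to record the observations.  The values of [rule t] for
   t >= T are irrelevant. *)
Record algorithm (T : nat) := Algorithm {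
  rule : forall t, t.-tuple R -> 'I_K ;
  answer : T.-tuple R -> 'I_K ;
  measurable_rule : forall t k, measurable (@rule t @^-1` [set k]) ;
  measurable_answer : forall k, measurable (answer @^-1` [set k]) }.

Fixpoint obs_law (mu : K.-tuple R) T (A : algorithm T) t :
    probability (t.-tuple R) R :=
  match t with
  | 0 => \d_([tuple] : 0.-tuple R)
  | t'.+1 => observe mu (obs_law mu A t') (measurable_rule A (t := t'))
  end.

Definition pulled_arm T (A : algorithm T) (x : T.-tuple R) (t : 'I_T) : 'I_K :=
  rule A [tuple nth 0 x i | i < t].

Definition pulls T (A : algorithm T) (x : T.-tuple R) (k : 'I_K) : nat :=
  #|[set t | pulled_arm A x t == k]|.

(* The empirical mean of an arm that was never pulled is 0, because y / 0 = 0 *)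
Definition empirical_means T (A : algorithm T) (x : T.-tuple R) : K.-tuple R :=
  [tuple (\sum_(t < T | pulled_arm A x t == k) tnth x t) / (pulls A x k)%:R
    | k < K].

(* The algorithm of index n has horizon n + 1, so that horizons are positive. *)
Definition algorithm_family := forall n : nat, algorithm n.+1.

Definition unique_best_arm : set (K.-tuple R) :=
  [set mu | exists i, forall j, j != i -> tnth mu j < tnth mu i].

(* Outside of [unique_best_arm], the values of i* are arbitrary, up to the
   measurability without which "the algorithm answers i* of the empirical means"
   is meaningless. *)
Definition best_arm_map (istar : K.-tuple R -> 'I_K) : Prop :=
  (forall mu, unique_best_arm mu ->
     forall j, j != istar mu -> tnth mu j < tnth mu (istar mu)) /\
  (forall k, measurable (istar @^-1` [set k])).

Variable istar : K.-tuple R -> 'I_K.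

Definition error_prob (mu : K.-tuple R) T (A : algorithm T) : R :=
  fine (obs_law mu A T [set x | answer A x <> istar mu]).

Definition hardness (mu : K.-tuple R) T (A : algorithm T) : \bar R :=
  let p := error_prob mu A in
  if p == 0 then 0%E else if p == 1 then +oo%E else (T%:R / ln p^-1)%:E.

Definition oracle_difficulty (C : set algorithm_family) (mu : K.-tuple R) :
    \bar R :=
  ereal_inf [set limn_esup (fun n => hardness mu (A n)) | A in C].

Definition open_simplex : set ('I_K -> R) :=
  [set w | (forall k, 0 < w k) /\ \sum_k w k = 1].

Definition static_proportions : set algorithm_family :=
  [set A | exists2 w, open_simplex w & forall n (x : n.+1.-tuple R),
     (forall k, `|(pulls (A n) x k)%:R - n.+1%:R * w k| <= K%:R) /\
     answer (A n) x = istar (empirical_means (A n) x)].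

Definition difficulty_ratio (H : K.-tuple R -> \bar R) T (A : algorithm T)
    (mu : K.-tuple R) : \bar R :=
  if H mu == 0%E then +oo%E else (hardness mu A / H mu)%E.

Definition limit_difficulty_ratio (H : K.-tuple R -> \bar R)
    (A : algorithm_family) (mu : K.-tuple R) : \bar R :=
  limn_esup (fun n => difficulty_ratio H (A n) mu).

End algorithms.

Arguments algorithm : clear implicits.
Arguments algorithm_family : clear implicits.
Arguments unique_best_arm : clear implicits.

(* Main.v *)
Require Import Defs.
From mathcomp Require Import all_boot all_order all_algebra.
From mathcomp Require Import all_classical all_reals all_analysis measurable_realfun.
From mathcomp Require Import ring lra.

Set Implicit Arguments.
Unset Strict Implicit.
Unset Printing Implicit Defensive.

Import Order.TTheory GRing.Theory Num.Theory numFieldNormedType.Exports.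
Local Open Scope classical_set_scope.
Local Open Scope ring_scope.

(* In the base problem, arm 0 has mean 0 and arm k > 0 has mean - K^k; problem
   i > 0 flips the sign of the mean of arm i.  Static proportions with weight
   1/2 on arm i show that the oracle difficulty of problem i is at most
   4 (i + 2) / K^(2 i), since the arms k > i are too far below to cost anything.
   Conversely, if an algorithm is accurate on the base problem and has ratio at
   most c on problem i, a change of measure shows that on the base problem it
   pulls arm i about T / (8 c (i + 2)) times in expectation.  These numbers of
   pulls sum to at most T, while the sum of the 1 / (i + 2) is at least
   (ln K) / 3: up to errors, c >= (ln K) / 24 > 3 / 80 ln K. *)

(** * Gaussian observations *)

Import HBNNSimple.

(** [observe] is given by its values on events only; this passes from events to nonnegative
    functions. The two sides agree on simple functions by linearity, and increasing simple
    approximations give the rest by monotone convergence. *)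
Lemma ge0_integral_weighted_pushforward d d' (X : measurableType d)
    (Y : measurableType d') (R : realType) (P : {measure set X -> \bar R})
    (m : {measure set Y -> \bar R}) (w : X -> R) (phi : X -> Y) :
  measurable_fun setT w -> (forall x, 0 <= w x) -> measurable_fun setT phi ->
  (forall E, measurable E ->
    m E = (\int[P]_x (w x * \1_E (phi x))%:E)%E) ->
  forall f : Y -> \bar R, measurable_fun setT f -> (forall y, (0 <= f y)%E) ->
  (\int[m]_y f y = \int[P]_x ((w x)%:E * f (phi x)))%E.
Proof.
move=> mw w0 mphi mE f mf f0.
pose g := nnsfun_approx measurableT mf.
have mg n : measurable_fun setT (fun x => w x * g n (phi x)).
  by apply: measurable_funM => //; exact: measurableT_comp.
have Hnn n : (\int[m]_y (g n y)%:E = \int[P]_x (w x * g n (phi x))%:E)%E.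
  have mind r : measurable_fun setT
      (fun x => w x * (r * \1_(g n @^-1` [set r]) (phi x))).
    apply: measurable_funM => //; apply: measurable_funM => //.
    by apply: measurableT_comp => //; exact: measurable_indic.
  transitivity (\sum_(r \in range (g n))
      \int[P]_x (w x * (r * \1_(g n @^-1` [set r]) (phi x)))%:E)%E.
    under eq_integral do rewrite fimfunE -fsumEFin//.
    rewrite ge0_integral_fsum//; last 2 first.
    - by move=> y; exact/measurable_EFinP/measurable_funM.
    - by move=> y x _; rewrite nnfun_muleindic_ge0.
    apply: eq_fsbigr => r; rewrite inE => -[y _ <-].
    rewrite integralZl_indic_nnsfun// integral_indic//= setIT mE//.
    rewrite -ge0_integralZl//.
    + by apply: eq_integral => x _; rewrite -EFinM mulrCA.
    + apply/measurable_EFinP/measurable_funM => //.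
      by apply: measurableT_comp => //; exact: measurable_indic.
    + by move=> x _; rewrite lee_fin mulr_ge0.
    + by rewrite lee_fin.
  rewrite -ge0_integral_fsum//.
  - apply: eq_integral => x _; rewrite [in RHS](fimfunE (g n) (phi x)).
    rewrite EFinM -fsumEFin// ge0_mule_fsumr.
      by apply: eq_fsbigr => r _; rewrite EFinM.
    by move=> r; rewrite nnfun_muleindic_ge0.
  - by move=> r; exact/measurable_EFinP.
  - move=> r x _; rewrite EFinM mule_ge0//; first by rewrite lee_fin.
    exact: nnfun_muleindic_ge0.
transitivity (limn (fun n => \int[m]_y (g n y)%:E))%E.
  rewrite -monotone_convergence//.
  - by apply: eq_integral => y _; apply/esym/cvg_lim => //; exact: cvg_nnsfun_approx.
  - by move=> n; exact/measurable_EFinP.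
  - by move=> n y _; rewrite lee_fin.
  - by move=> y _ i j ij; rewrite lee_fin; exact/lefP/nd_nnsfun_approx.
under eq_fun do rewrite Hnn.
rewrite -monotone_convergence//.
- apply: eq_integral => x _; apply/cvg_lim => //.
  under eq_fun do rewrite EFinM.
  by apply: cvgeZl => //; exact: cvg_nnsfun_approx.
- by move=> n; exact/measurable_EFinP.
- by move=> n x _; rewrite lee_fin mulr_ge0.
- move=> x _ i j ij; rewrite lee_fin ler_wpM2l//.
  exact/lefP/nd_nnsfun_approx.
Qed.

Lemma measurable_finite_comp d d' (X : measurableType d) (Y : measurableType d')
    (I : finType) (a : X -> I) (g : I -> Y) :
  (forall i, measurable (a @^-1` [set i])) -> measurable_fun setT (g \o a).
Proof.
move=> ma _ B _; rewrite setTI.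
rewrite (_ : _ @^-1` B = \bigcup_(i in [set i | B (g i)]) a @^-1` [set i]).
  by apply: fin_bigcup_measurable => [|i _]; [exact: finite_finset|exact: ma].
by apply/seteqP; split=> [x Bx|x [i Bi /= ->//]]; exists (a x).
Qed.

Lemma measurable_tuple_rcons d (T : measurableType d) t :
  measurable_fun [set: t.-tuple T * T]
    (fun hy => [tuple of rcons hy.1 hy.2] : t.+1.-tuple T).
Proof.
apply/measurable_fun_tnthP => i.
have [it|ti] := ltnP i t.
  rewrite (_ : _ \o _ = (fun hy : t.-tuple T * T => tnth hy.1 (Ordinal it))).
    exact: (measurableT_comp (measurable_tnth (Ordinal it)) measurable_fst).
  apply/funext => -[h y] /=.
  by rewrite (tnth_nth y) /= nth_rcons size_tuple it (tnth_nth y).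
rewrite (_ : _ \o _ = snd); first exact: measurable_snd.
apply/funext => -[h y] /=; rewrite (tnth_nth y) /= nth_rcons size_tuple.
have -> : nat_of_ord i = t by apply/anti_leq; rewrite ti -ltnS ltn_ord.
by rewrite ltnn eqxx.
Qed.

Lemma normal_pdf1E (R : realType) (m y : R) :
  normal_pdf m 1 y = normal_peak 1 * expR (- (y - m) ^+ 2 / 2).
Proof. by rewrite normal_pdfE ?oner_eq0// /normal_fun expr1n. Qed.

(** Exponential tilting of a Gaussian, by completing the square. The logarithm of the factor is one
    summand of [log_likelihood_ratio]. *)
Lemma normal_pdf1_shift (R : realType) (m th y : R) :
  normal_pdf (m + th) 1 y =
  normal_pdf m 1 y * expR (th * (y - m) - th ^+ 2 / 2).
Proof. by rewrite !normal_pdf1E -mulrA -expRD; congr (_ * expR _); field. Qed.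

Section observe.
Context {R : realType} {K t : nat}.
Variables (mu : K.-tuple R) (P : probability (t.-tuple R) R).
Variables (a : t.-tuple R -> 'I_K) (ma : forall k, measurable (a @^-1` [set k])).

(** Joint density of a history and the next observation with respect to the product of [P] and
    Lebesgue measure. *)
Let w (hy : t.-tuple R * R) := normal_pdf (tnth mu (a hy.1)) 1 hy.2.

Let mw : measurable_fun setT w.
Proof.
rewrite (_ : w = fun hy => normal_peak 1 *
    expR (- (hy.2 - tnth mu (a hy.1)) ^+ 2 / 2)).
  apply: measurable_funM => //; apply: measurableT_comp => //.
  apply: measurable_funM => //; apply: measurableT_comp => //.
  apply: measurable_funX => //; apply: measurable_funB => //.
  apply: (@measurableT_comp _ _ _ _ _ _ (tnth mu \o a)) => //.
  exact: measurable_finite_comp.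
by apply/funext => hy; rewrite /w normal_pdf1E.
Qed.

Let w0 hy : 0 <= w hy. Proof. exact: normal_pdf_ge0. Qed.

Variables (f : t.+1.-tuple R -> \bar R).
Hypotheses (mf : measurable_fun setT f) (f0 : forall x, (0 <= f x)%E).

Let integrand (hy : t.-tuple R * R) := ((w hy)%:E * f [tuple of rcons hy.1 hy.2])%E.

Let mintegrand : measurable_fun setT integrand.
Proof.
apply: emeasurable_funM; first exact/measurable_EFinP.
apply: (@measurableT_comp _ _ _ _ _ _ f) => //; exact: measurable_tuple_rcons.
Qed.

Let integrand_ge0 hy : (0 <= integrand hy)%E.
Proof. by rewrite mule_ge0// lee_fin. Qed.

Lemma measurable_observe_integrand : measurable_fun setT (fun h : t.-tuple R =>
  \int[lebesgue_measure]_y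
    ((normal_pdf (tnth mu (a h)) 1 y)%:E * f [tuple of rcons h y]))%E.
Proof.
have := @measurable_fun_fubini_tonelli_F _ _ _ _ R lebesgue_measure _
  mintegrand integrand_ge0.
by rewrite /fubini_F.
Qed.

(** [observe] is the image under [rcons] of the measure with density [w], and Tonelli separates the
    history from the new observation. *)
Lemma ge0_integral_observe :
  (\int[observe mu P ma]_x f x = \int[P]_h \int[lebesgue_measure]_y
    ((normal_pdf (tnth mu (a h)) 1 y)%:E * f [tuple of rcons h y]))%E.
Proof.
rewrite (@ge0_integral_weighted_pushforward _ _ _ _ _
  (P \x lebesgue_measure)%E _ w (fun hy => [tuple of rcons hy.1 hy.2]))//.
- by rewrite fubini_tonelli1.
- exact: measurable_tuple_rcons.
move=> E mE.
have mwE : measurable_fun setT (fun hy : t.-tuple R * R =>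
    (w hy * \1_E [tuple of rcons hy.1 hy.2])%:E).
  apply/measurable_EFinP/measurable_funM => //; apply: measurableT_comp.
    exact: measurable_indic.
  exact: measurable_tuple_rcons.
rewrite fubini_tonelli1; [|exact: mwE|by move=> hy; rewrite lee_fin mulr_ge0].
apply: eq_integral => h _; rewrite /normal_prob integral_mkcond.
apply: eq_integral => y _; rewrite patchE indicE /w /=.
have [Ey|NEy] := pselect (E [tuple of rcons h y]).
  by rewrite !mem_set// mulr1.
by rewrite !memNset// mulr0.
Qed.

End observe.

(** * Change of measure *)

Section change_of_measure.
Context {R : realType} {K T : nat}.
Variable A : algorithm R K T.

(** Takes a bare sequence, so that one expression serves a history and its extensions; on full
    histories it unfolds to [pulled_arm]. *)
Definition arm_at (x : seq R) (t : nat) : 'I_K :=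
  rule A [tuple nth 0 x i | i < t].

Lemma measurable_arm_at t (j : 'I_t) k :
  measurable ((fun x : t.-tuple R => arm_at x j) @^-1` [set k]).
Proof.
have mpre : measurable_fun [set: t.-tuple R]
    (fun x => [tuple nth 0 x i | i < j]).
  apply/measurable_fun_tnthP => i.
  rewrite (_ : _ \o _ = fun x : t.-tuple R =>
    tnth x (widen_ord (ltnW (ltn_ord j)) i)); first exact: measurable_tnth.
  by apply/funext => x /=; rewrite tnth_mktuple (tnth_nth 0).
rewrite -[X in measurable X]setTI -[_ @^-1` _]/((fun x : t.-tuple R =>
  [tuple nth 0 x i | i < j]) @^-1` (@rule _ _ _ A j @^-1` [set k])).
by apply: mpre => //; exact: measurable_rule.
Qed.

Lemma measurable_comp_arm_at t (g : 'I_K -> R) (j : 'I_t) :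
  measurable_fun setT (fun x : t.-tuple R => g (arm_at x j)).
Proof.
by apply: (@measurable_finite_comp _ _ _ _ _ _ g) => k; exact: measurable_arm_at.
Qed.

Lemma arm_at_rcons t (h : t.-tuple R) y (j : 'I_t) :
  arm_at (rcons h y) j = arm_at h j.
Proof.
congr (rule A); apply: eq_from_tnth => i; rewrite !tnth_mktuple nth_rcons.
by rewrite size_tuple (ltn_trans (ltn_ord i) (ltn_ord j)).
Qed.

Lemma arm_at_rcons_max t (h : t.-tuple R) y : arm_at (rcons h y) t = rule A h.
Proof.
congr (rule A); apply: eq_from_tnth => i.
by rewrite tnth_mktuple nth_rcons size_tuple ltn_ord (tnth_nth 0).
Qed.

Variables (mu : K.-tuple R) (th : 'I_K -> R).

Definition shift_means : K.-tuple R := [tuple tnth mu k + th k | k < K].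

Definition log_likelihood_ratio t (x : t.-tuple R) : R :=
  \sum_(j < t) (th (arm_at x j) * (tnth x j - tnth mu (arm_at x j))
    - th (arm_at x j) ^+ 2 / 2).

Lemma measurable_log_likelihood_ratio t :
  measurable_fun setT (@log_likelihood_ratio t).
Proof.
apply: measurable_sum => j.
apply: measurable_funB; last first.
  exact: (measurable_comp_arm_at (fun k => th k ^+ 2 / 2)).
apply: measurable_funM; first exact: measurable_comp_arm_at.
apply: measurable_funB; first exact: measurable_tnth.
exact: measurable_comp_arm_at.
Qed.

Lemma log_likelihood_ratio_rcons t (h : t.-tuple R) y :
  log_likelihood_ratio [tuple of rcons h y] = log_likelihood_ratio h +
  (th (rule A h) * (y - tnth mu (rule A h)) - th (rule A h) ^+ 2 / 2).
Proof.
rewrite /log_likelihood_ratio big_ord_recr /= arm_at_rcons_max.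
congr (_ + (_ * (_ - _) - _)).
  apply: eq_bigr => j _; rewrite arm_at_rcons; congr (_ * (_ - _) - _).
  by rewrite (tnth_nth 0) /= nth_rcons size_tuple ltn_ord (tnth_nth 0).
by rewrite (tnth_nth 0) /= nth_rcons size_tuple ltnn eqxx.
Qed.

(** Induction on the rounds: both problems choose the next arm by the same function of the history,
    so a round multiplies the ratio by a quotient of two Gaussian densities. Quantifying over all
    nonnegative [f] lets the induction hypothesis apply to the inner integral. *)
Lemma ge0_integral_shift t (f : t.-tuple R -> \bar R) :
  measurable_fun setT f -> (forall x, (0 <= f x)%E) ->
  (\int[obs_law shift_means A t]_x f x =
   \int[obs_law mu A t]_x ((expR (log_likelihood_ratio x))%:E * f x))%E.
Proof.
elim: t f => [|t IH] f mf f0.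
  apply: eq_integral => x _.
  by rewrite /log_likelihood_ratio big_ord0 expR0 mul1e.
have mfL : measurable_fun setT
    (fun x => (expR (log_likelihood_ratio x))%:E * f x)%E.
  apply: emeasurable_funM => //; apply/measurable_EFinP.
  by apply: measurableT_comp => //; exact: measurable_log_likelihood_ratio.
have fL0 x : (0 <= (expR (log_likelihood_ratio x))%:E * f x)%E.
  by rewrite mule_ge0// lee_fin expR_ge0.
rewrite [LHS]ge0_integral_observe// [RHS]ge0_integral_observe//.
rewrite IH; last 2 first.
- apply: (@measurable_observe_integrand _ _ _ shift_means (@rule _ _ _ A t)) => //.
  by move=> k; exact: measurable_rule.
- move=> h; apply: integral_ge0 => y _.
  by rewrite mule_ge0// lee_fin normal_pdf_ge0.
apply: eq_integral => h _.
have mg : measurable_fun [set: R] (fun y =>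
    (normal_pdf (tnth shift_means (rule A h)) 1 y)%:E * f [tuple of rcons h y])%E.
  apply: emeasurable_funM.
    by apply/measurable_EFinP; exact: measurable_normal_pdf.
  apply: (@measurableT_comp _ _ _ _ _ _ f) => //.
  pose r (hy : t.-tuple R * R) : t.+1.-tuple R := [tuple of rcons hy.1 hy.2].
  apply: (@measurableT_comp _ _ _ _ _ _ r _ (pair h)).
    exact: measurable_tuple_rcons.
  exact: pair1_measurable.
rewrite -ge0_integralZl//; last first.
  by move=> y _; rewrite mule_ge0// lee_fin normal_pdf_ge0.
apply: eq_integral => y _.
rewrite tnth_mktuple normal_pdf1_shift log_likelihood_ratio_rcons expRD.
rewrite !muleA -!EFinM; congr (_%:E * _)%E; ring.
Qed.

End change_of_measure.

(** * Inequalities from likelihood ratios *)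

Section likelihood_ratio_bounds.
Context {R : realType} {K T : nat}.
Variables (A : algorithm R K T) (mu : K.-tuple R).
Implicit Types (th : 'I_K -> R) (k : 'I_K) (x : T.-tuple R).

Lemma obs_law_setT t : obs_law mu A t [set: t.-tuple R] = 1%E.
Proof. exact: probability_setT. Qed.

Lemma integral_cst_obs_law (c : R) : (\int[obs_law mu A T]_x c%:E = c%:E)%E.
Proof.
rewrite integral_cst//; transitivity (c%:E * 1)%E; last by rewrite mule1.
by congr (_ * _)%E; exact: obs_law_setT.
Qed.

Lemma integral_likelihood_ratio th :
  (\int[obs_law mu A T]_x (expR (log_likelihood_ratio A mu th x))%:E = 1)%E.
Proof.
have /esym := @ge0_integral_shift R K T A mu th T (cst 1%E) (measurable_cst _)
  (fun=> lee01).
rewrite integral_cst// mul1e [X in _ = X -> _]probability_setT => <-.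
by apply: eq_integral => x _; rewrite mule1.
Qed.

Lemma likelihood_ratio_event th E : measurable E ->
  (\int[obs_law mu A T]_x (expR (log_likelihood_ratio A mu th x) * \1_E x)%:E
   = obs_law (shift_means mu th) A T E)%E.
Proof.
move=> mE; rewrite -[E in RHS]setIT -integral_indic// ge0_integral_shift//.
by apply/measurable_EFinP; exact: measurable_indic.
Qed.

(** The log ratio is a linear term minus a quadratic one in the shift, so reversing and scaling the
    shift changes it by a multiple of the quadratic term alone. *)
Lemma log_likelihood_ratioN th s x :
  log_likelihood_ratio A mu (fun k => - s * th k) x =
  - s * log_likelihood_ratio A mu th x -
  s * (1 + s) / 2 * \sum_(j < T) th (arm_at A x j) ^+ 2.
Proof.
rewrite /log_likelihood_ratio !mulr_sumr -sumrB.
by apply: eq_bigr => j _; field.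
Qed.

(* With L and D the likelihood ratios of the shifts th and - s th,
   log L = - s^-1 log D - (1 + s) / 2 * Q, where Q is the sum below.  Bounding
   both exponentials by their tangents makes everything nonnegative, and D has
   integral 1, so no integrability of log L is needed. *)
Lemma change_of_measure_lower_bound th E (s z v : R) : measurable E -> 0 < s -> 0 <= z ->
  (\int[obs_law mu A T]_x (\sum_(j < T) th (arm_at A x j) ^+ 2)%:E <= v%:E)%E ->
  (1 + z + s^-1) * fine (obs_law mu A T E) <=
    expR z * fine (obs_law (shift_means mu th) A T E) + s^-1 + (1 + s) / 2 * v.
Proof.
move=> mE s0 z0 hv.
pose L := @log_likelihood_ratio R K T A mu th T.
pose D := @log_likelihood_ratio R K T A mu (fun k => - s * th k) T.
pose Q x := \sum_(j < T) th (arm_at A x j) ^+ 2.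
have Q0 x : 0 <= Q x by apply: sumr_ge0 => j _; exact: sqr_ge0.
have mQ : measurable_fun setT Q.
  by apply: measurable_sum => j; exact: (measurable_comp_arm_at A (fun k => th k ^+ 2)).
have mL : measurable_fun setT (expR \o L).
  by apply: measurableT_comp => //; exact: measurable_log_likelihood_ratio.
have mD : measurable_fun setT (expR \o D).
  by apply: measurableT_comp => //; exact: measurable_log_likelihood_ratio.
have mI : measurable_fun setT (\1_E : T.-tuple R -> R) by exact: measurable_indic.
have s1 : 0 <= (1 + s) / 2 by rewrite divr_ge0// addr_ge0// ltW.
have si0 : 0 <= s^-1 by rewrite invr_ge0 ltW.
have c0 : 0 <= 1 + z + s^-1 by rewrite !addr_ge0.
(* On [E], add the tangent bounds for [expR (L x + z)] and, scaled by [s^-1], for [expR (D x)]; by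
   [LE] the terms in [L], [D] and [Q] cancel. Off [E] the right side is nonnegative. *)
have pw x : (1 + z + s^-1) * \1_E x <=
    expR z * (expR (L x) * \1_E x) + s^-1 * expR (D x) + (1 + s) / 2 * Q x.
  have h1 := expR_ge1Dx (L x + z); have h2 := expR_ge1Dx (D x).
  have DE : D x = - s * L x - s * (1 + s) / 2 * Q x by exact: log_likelihood_ratioN.
  have LE : L x = - (s^-1 * D x) - (1 + s) / 2 * Q x.
    by rewrite DE; field; rewrite gt_eqF.
  have h3 : s^-1 * (1 + D x) <= s^-1 * expR (D x) by rewrite ler_pM2l// invr_gt0.
  rewrite indicE; case: (x \in E); rewrite /= ?mulr1 ?mulr0.
    by rewrite -expRD (addrC z); lra.
  by rewrite add0r addr_ge0// mulr_ge0 ?expR_ge0.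
have : (\int[obs_law mu A T]_x ((1 + z + s^-1) * \1_E x)%:E <=
  \int[obs_law mu A T]_x (expR z * (expR (L x) * \1_E x) + s^-1 * expR (D x)
     + (1 + s) / 2 * Q x)%:E)%E.
  apply: ge0_le_integral => //.
  - by move=> x _; rewrite lee_fin mulr_ge0.
  - by apply/measurable_EFinP; exact: measurable_funM.
  - by apply/measurable_EFinP; do ?[apply: measurable_funD|apply: measurable_funM].
  - by move=> x _; rewrite lee_fin.
have LI0 x : 0 <= expR (L x) * \1_E x by rewrite mulr_ge0 ?expR_ge0.
have mLI : measurable_fun setT (fun x => (expR (L x) * \1_E x)%:E).
  by apply/measurable_EFinP; exact: measurable_funM.
under eq_integral do rewrite EFinM.
rewrite ge0_integralZl_EFin//; last exact/measurable_EFinP.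
rewrite integral_indic// setIT.
under eq_integral do rewrite !EFinD (EFinM (expR z)) (EFinM s^-1) (EFinM ((1 + s) / 2)).
rewrite ge0_integralD//; last 4 first.
- move=> x _; rewrite -!EFinM -EFinD lee_fin.
  by rewrite addr_ge0// mulr_ge0 ?expR_ge0.
- apply: emeasurable_funD; first exact: measurable_funeM.
  by apply: measurable_funeM; exact/measurable_EFinP.
- by move=> x _; rewrite -EFinM lee_fin mulr_ge0.
- by apply: measurable_funeM; exact/measurable_EFinP.
rewrite ge0_integralD//; last 3 first.
- exact: measurable_funeM.
- by move=> x _; rewrite -EFinM lee_fin mulr_ge0 ?expR_ge0.
- by apply: measurable_funeM; exact/measurable_EFinP.
rewrite !ge0_integralZl_EFin//; last 3 first.
- by move=> x _; rewrite lee_fin.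
- exact/measurable_EFinP.
- exact/measurable_EFinP.
rewrite integral_likelihood_ratio likelihood_ratio_event// mule1 => h.
rewrite -lee_fin !EFinD !EFinM !fineK ?fin_num_measure//.
apply: (le_trans h); apply: leeD => //.
by apply: lee_pmul => //; apply: integral_ge0 => x _; rewrite lee_fin.
Qed.

(** * Numbers of pulls *)

Lemma pullsE x k : (pulls A x k)%:R = \sum_(j < T) (arm_at A x j == k)%:R :> R.
Proof.
rewrite /pulls -sum1_card natr_sum big_mkcond/=; apply: eq_bigr => j _.
case: ifPn; rewrite -[arm_at A x j]/(pulled_arm A x j).
  by rewrite in_setE /= => ->.
by move/negP; rewrite in_setE /= => /negP/negbTE ->.
Qed.

Lemma sum_pulls x : (\sum_k pulls A x k)%N = T.
Proof.
apply/eqP; rewrite -(eqr_nat R) natr_sum; apply/eqP.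
under eq_bigr do rewrite pullsE.
rewrite exchange_big/= -[in RHS](card_ord T) -sum1_card natr_sum.
apply: eq_bigr => j _; rewrite (bigD1 (arm_at A x j))//= eqxx big1 ?addr0//.
by move=> k /negbTE; rewrite eq_sym => ->.
Qed.

Definition expected_pulls k : R :=
  fine (\int[obs_law mu A T]_x (pulls A x k)%:R%:E).

Lemma measurable_pulls k :
  measurable_fun setT (fun x => (pulls A x k)%:R%:E : \bar R).
Proof.
apply/measurable_EFinP; under eq_fun do rewrite pullsE.
by apply: measurable_sum => j; exact: (measurable_comp_arm_at A (fun l => (l == k)%:R)).
Qed.

(** An arm is pulled at most [T] times, so the integral is finite and [fine] loses nothing. *)
Lemma integral_pulls k :
  (\int[obs_law mu A T]_x (pulls A x k)%:R%:E = (expected_pulls k)%:E)%E.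
Proof.
rewrite fineK// ge0_fin_numE; last by apply: integral_ge0 => x _; rewrite lee_fin.
apply: (@le_lt_trans _ _ (\int[obs_law mu A T]_x T%:R%:E)%E).
  apply: ge0_le_integral => //.
  - exact: measurable_pulls.
  - move=> x _; rewrite lee_fin ler_nat -[leqRHS](sum_pulls x).
    by rewrite (bigD1 k)//= leq_addr.
by rewrite integral_cst_obs_law ltry.
Qed.

Lemma expected_pulls_ge0 k : 0 <= expected_pulls k.
Proof. by apply: fine_ge0; apply: integral_ge0 => x _; rewrite lee_fin. Qed.

Lemma sum_expected_pulls : \sum_k expected_pulls k = T%:R.
Proof.
apply: EFin_inj; rewrite -sumEFin.
under eq_bigr do rewrite -integral_pulls.
rewrite -ge0_integral_sum//; last by move=> k; exact: measurable_pulls.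
under eq_integral do rewrite sumEFin -natr_sum sum_pulls.
by rewrite integral_cst_obs_law.
Qed.

End likelihood_ratio_bounds.

Section expected_pulls_bounds.
Context {R : realType} {K T : nat}.
Variables (A : algorithm R K T) (mu : K.-tuple R).

(** When a single arm is shifted by [d], the quadratic term is [d ^+ 2] times the number of pulls of
    that arm. *)
Lemma change_of_arm_lower_bound i (d s z : R) E : measurable E -> 0 < s -> 0 <= z ->
  (1 + z + s^-1) * fine (obs_law mu A T E) <=
    expR z * fine (obs_law (shift_means mu (fun k => if k == i then d else 0)) A T E)
    + s^-1 + (1 + s) / 2 * (d ^+ 2 * expected_pulls A mu i).
Proof.
move=> mE s0 z0; apply: change_of_measure_lower_bound => //.
rewrite EFinM -integral_pulls -ge0_integralZl_EFin ?sqr_ge0//;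
  last exact: measurable_pulls.
rewrite le_eqVlt; apply/orP; left; apply/eqP/eq_integral => x _.
rewrite -EFinM pullsE mulr_sumr; congr _%:E.
apply: eq_bigr => j _; case: eqP => _; first by rewrite mulr1.
by rewrite expr0n/= mulr0.
Qed.

(** On [E] the sum of the [K] likelihood ratios is at least [expR c], while each of them has
    integral 1: Markov's inequality and a union bound in one step. *)
Lemma chernoff_bound (th : 'I_K -> 'I_K -> R) E c : measurable E ->
  (forall x : T.-tuple R, E x ->
    exists j, c <= log_likelihood_ratio A mu (th j) x) ->
  fine (obs_law mu A T E) <= K%:R * expR (- c).
Proof.
move=> mE hE.
have mI : measurable_fun setT (fun x : T.-tuple R => (\1_E x)%:E : \bar R).
  by apply/measurable_EFinP; exact: measurable_indic.
have mL j : measurable_fun setT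
    (fun x => (expR (@log_likelihood_ratio R K T A mu (th j) T x))%:E).
  apply/measurable_EFinP; apply: measurableT_comp => //.
  exact: measurable_log_likelihood_ratio.
have : (\int[obs_law mu A T]_x ((expR c)%:E * (\1_E x)%:E) <=
    \int[obs_law mu A T]_x
      \sum_(j < K) (expR (log_likelihood_ratio A mu (th j) x))%:E)%E.
  apply: ge0_le_integral => //.
  - exact: measurable_funeM.
  - exact: emeasurable_sum.
  move=> x _; rewrite sumEFin -EFinM lee_fin indicE.
  have [/set_mem/hE[j cj]|_] := boolP (x \in E); last first.
    by rewrite mulr0 sumr_ge0// => j _; exact: expR_ge0.
  rewrite mulr1 (bigD1 j)//= -[leLHS]addr0 lerD ?ler_expR//.
  by rewrite sumr_ge0// => k _; exact: expR_ge0.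
rewrite ge0_integralZl_EFin ?expR_ge0//.
rewrite integral_indic// setIT ge0_integral_sum//.
under eq_bigr do rewrite integral_likelihood_ratio.
rewrite sumEFin sumr_const card_ord => h.
rewrite expRN ler_pdivlMr ?expR_gt0// mulrC -lee_fin EFinM fineK//.
exact: fin_num_measure.
Qed.

End expected_pulls_bounds.

(** * Static proportions *)

Section allocation.
Context {R : realType} {K : nat}.

Lemma sum_nth_eq (I : eqType) (x0 k : I) (s : seq I) :
  \sum_(j < size s) (nth x0 s j == k)%:R = (count_mem k s)%:R :> R.
Proof.
rewrite -(big_mkord xpredT (fun j => (nth x0 s j == k)%:R : R)).
rewrite -(big_nth x0 xpredT (fun y => (y == k)%:R : R)) -sum1_count natr_sum.
by rewrite [RHS]big_mkcond/=; apply: eq_bigr => y _; case: eqP.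
Qed.

(** Round [T%:R * w k] down for every arm but arm 0, which takes the remaining rounds. Each rounding
    loses less than 1, so arm 0 gains at most the number of other arms. The schedule [s] pulls the
    arms in consecutive blocks. *)
Lemma allocation_exists (w : 'I_K -> R) T : open_simplex w ->
  exists a : nat -> 'I_K,
    forall k, `|\sum_(j < T) (a j == k)%:R - T%:R * w k| <= K%:R.
Proof.
move=> [w0 w1].
case: K w w0 w1 => [|K'] w w0 w1.
  by move: w1; rewrite big_ord0 => /esym/eqP; rewrite oner_eq0.
have tr k : (Num.truncn (T%:R * w k))%:R <= T%:R * w k < (Num.truncn (T%:R * w k))%:R + 1.
  by rewrite natr1 truncn_itv// mulr_ge0// ltW.
pose n0 := (\sum_(k | k != ord0) Num.truncn (T%:R * w k))%N.
have n0E : n0%:R = \sum_(k | k != ord0) (Num.truncn (T%:R * w k))%:R :> R.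
  by rewrite natr_sum.
have w1' : w ord0 + \sum_(k | k != ord0) w k = 1.
  by rewrite -w1 [in RHS](bigD1 ord0).
have Tw : T%:R * w ord0 + \sum_(k | k != ord0) T%:R * w k = T%:R.
  by rewrite -mulr_sumr -mulrDr w1' mulr1.
have n0T : (n0 <= T)%N.
  rewrite -(ler_nat R) -Tw n0E -[leLHS]add0r lerD ?mulr_ge0 ?(ltW (w0 _))//.
  by apply: ler_sum => k _; have /andP[] := tr k.
pose n k := if k == ord0 then (T - n0)%N else Num.truncn (T%:R * w k).
pose s := flatten [seq nseq (n k) k | k <- enum 'I_K'.+1].
have cs k : count_mem k s = n k.
  rewrite /s count_flatten -map_comp sumnE big_map big_enum/=.
  rewrite (bigD1 k)//= count_nseq/= eqxx mul1n big1 ?addn0// => l /negbTE lk.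
  by rewrite count_nseq/= lk mul0n.
have ss : size s = T.
  rewrite /s size_flatten /shape -map_comp sumnE big_map big_enum/=.
  rewrite (bigD1 ord0)//= size_nseq /n eqxx (eq_bigr (fun k => Num.truncn (T%:R * w k))).
    by rewrite -/n0 subnK.
  by move=> k /negbTE k0 /=; rewrite size_nseq k0.
exists (nth ord0 s) => k.
have -> : \sum_(j < T) (nth ord0 s j == k)%:R = (n k)%:R :> R.
  by rewrite -cs -(sum_nth_eq ord0) ss.
rewrite /n.
have K1 : 1 <= K'.+1%:R :> R by rewrite ler1n.
case: eqP => [->|_]; last first.
  have /andP[? ?] := tr k; rewrite distrC ger0_norm => [|]; lra.
rewrite natrB// n0E -{1}Tw.
rewrite (_ : _ - _ = \sum_(k | k != ord0) (T%:R * w k - (Num.truncn (T%:R * w k))%:R)).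
  rewrite ger0_norm; last by apply: sumr_ge0 => l _; have /andP[? ?] := tr l; lra.
  apply: (@le_trans _ _ (\sum_(k < K'.+1 | k != ord0) 1)).
    by apply: ler_sum => l _; have /andP[? ?] := tr l; lra.
  rewrite big_mkcond/= -[in leRHS](card_ord K'.+1) -sum1_card natr_sum.
  by apply: ler_sum => l _; case: ifP.
by rewrite sumrB; ring.
Qed.

End allocation.

Section nonadaptive.
Context {R : realType} {K T : nat}.
Variable a : nat -> 'I_K.

Lemma measurable_constant_rule t k :
  measurable ((fun _ : t.-tuple R => a t) @^-1` [set k]).
Proof.
have [<-|ak] := eqVneq (a t) k.
  by rewrite (_ : _ @^-1` _ = setT)//; apply/seteqP; split.
rewrite (_ : _ @^-1` _ = set0)//; apply/seteqP; split => // x /= ak'.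
by rewrite ak' eqxx in ak.
Qed.

Definition nonadaptive (ans : T.-tuple R -> 'I_K)
    (mans : forall k, measurable (ans @^-1` [set k])) : algorithm R K T :=
  Algorithm measurable_constant_rule mans.

(** A placeholder answer breaks a circularity: the empirical means depend on the sampling rule only,
    and the actual answer will be computed from them. *)
Let silent : algorithm R K T :=
  nonadaptive (fun k => measurable_constant_rule (t := T) k).

Definition scheduled_means (x : T.-tuple R) : K.-tuple R :=
  empirical_means silent x.

Definition scheduled_pulls k : R := \sum_(j < T) (a j == k)%:R.

Lemma pulls_nonadaptive ans mans x k :
  (pulls (@nonadaptive ans mans) x k)%:R = scheduled_pulls k.
Proof. by rewrite pullsE. Qed.

Lemma tnth_scheduled_means x k : tnth (scheduled_means x) k =
  (\sum_(j < T | a j == k) tnth x j) / scheduled_pulls k.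
Proof. by rewrite tnth_mktuple pulls_nonadaptive. Qed.

Lemma measurable_scheduled_means : measurable_fun setT scheduled_means.
Proof.
apply/measurable_fun_tnthP => k.
rewrite (_ : _ \o _ = fun x : T.-tuple R =>
    (\sum_(j < T) (a j == k)%:R * tnth x j) / scheduled_pulls k).
  apply: measurable_funM => //; apply: measurable_sum => j.
  by apply: measurable_funM => //; exact: measurable_tnth.
apply/funext => x /=; rewrite tnth_scheduled_means big_mkcond/=; congr (_ / _).
by apply: eq_bigr => j _; case: eqP; rewrite ?mul1r ?mul0r.
Qed.

(** Grouping the rounds by arm shows that the empirical means are sufficient. Every arm must be
    pulled, since an average over no samples is 0 by convention. *)
Lemma log_likelihood_ratio_nonadaptive ans mans mu (th : 'I_K -> R) x :
  (forall k, 0 < scheduled_pulls k) ->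
  log_likelihood_ratio (@nonadaptive ans mans) mu th x =
  \sum_k scheduled_pulls k *
    (th k * (tnth (scheduled_means x) k - tnth mu k) - th k ^+ 2 / 2).
Proof.
move=> N0; rewrite /log_likelihood_ratio.
rewrite (partition_big (fun j : 'I_T => a j) xpredT)//=.
apply: eq_bigr => k _; rewrite tnth_scheduled_means.
transitivity (\sum_(j < T | a j == k)
    (th k * (tnth x j - tnth mu k) - th k ^+ 2 / 2)).
  by apply: eq_bigr => j /eqP ajk; rewrite /arm_at /= ajk.
rewrite sumrB -mulr_sumr sumrB !sumr_const.
have -> : scheduled_pulls k = #|[pred j : 'I_T | a j == k]|%:R.
  rewrite /scheduled_pulls -sum1_card natr_sum [RHS]big_mkcond/=.
  by apply: eq_bigr => j _; rewrite inE; case: eqP.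
have c0 : #|[pred j : 'I_T | a j == k]|%:R != 0 :> R.
  have := N0 k; rewrite lt0r => /andP[+ _]; apply: contra_neq => <-.
  rewrite /scheduled_pulls -sum1_card natr_sum [RHS]big_mkcond/=.
  by apply: eq_bigr => j _; rewrite inE; case: eqP.
move: #|_| c0 => c c0.
rewrite -(mulr_natl (tnth mu k) c) -(mulr_natl (th k ^+ 2 / 2) c).
by move: c%:R c0 (\sum_(j < T | _) _) => C c0 S; field.
Qed.

End nonadaptive.

Section static_error.
Context {R : realType} {K T : nat}.
Variables (istar : K.-tuple R -> 'I_K) (istarP : best_arm_map istar).
Variable a : nat -> 'I_K.
Local Notation N := (@scheduled_pulls R K T a).

Lemma best_arm_map_eq (mu : K.-tuple R) b :
  (forall j, j != b -> tnth mu j < tnth mu b) -> istar mu = b.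
Proof.
move=> hb; apply/eqP; apply: contraT => nb.
have := istarP.1 mu (ex_intro _ b hb) b; rewrite eq_sym nb => /(_ isT) bi.
by have := lt_trans bi (hb _ nb); rewrite ltxx.
Qed.

Lemma measurable_static_answer k :
  measurable ((fun x : T.-tuple R => istar (scheduled_means a x)) @^-1` [set k]).
Proof.
rewrite -[X in measurable X]setTI.
rewrite -[_ @^-1` _]/(@scheduled_means R K T a @^-1` (istar @^-1` [set k])).
by apply: (@measurable_scheduled_means R K T a) => //; exact: istarP.2.
Qed.

Definition static_algorithm : algorithm R K T :=
  nonadaptive a measurable_static_answer.

(** On an error some arm [j] looks at least as good as [b]; the Chernoff bound then applies with one
    shift for each such [j]. *)
Lemma static_error_le (mu : K.-tuple R) b c :
  (forall j, j != b -> tnth mu j < tnth mu b) -> (forall k, 0 < N k) ->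
  (forall j, j != b ->
    2 * c * ((N b)^-1 + (N j)^-1) <= (tnth mu b - tnth mu j) ^+ 2) ->
  error_prob istar mu static_algorithm <= K%:R * expR (- c).
Proof.
move=> hb N0 hc.
(* The shift [th j] is the cheapest one, for squares weighted by the numbers of pulls, that gives
   arms [b] and [j] equal means. *)
pose eta j := (tnth mu b - tnth mu j) / ((N b)^-1 + (N j)^-1).
pose th j k := if k == b then - (eta j / N b) else if k == j then eta j / N j else 0.
rewrite /error_prob; apply: (chernoff_bound (th := th)).
  rewrite (_ : [set x | _] = ~` ((fun x : T.-tuple R =>
      istar (scheduled_means a x)) @^-1` [set istar mu])); last by apply/seteqP; split.
  by apply: measurableC; exact: measurable_static_answer.
move=> x; rewrite /= (best_arm_map_eq hb) => xb.
have [j jb mj] : exists2 j, j != b &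
    tnth (scheduled_means a x) b <= tnth (scheduled_means a x) j.
  apply: contrapT => /forall2NP h; apply: xb; apply: best_arm_map_eq => j jb.
  by rewrite ltNge; apply/negP; have [] := h j.
exists j; rewrite log_likelihood_ratio_nonadaptive// (bigD1 b)//= (bigD1 j)//=.
rewrite big1 ?addr0; last first.
  by move=> k /andP[kb kj]; rewrite /th (negbTE kb) (negbTE kj); ring.
rewrite /th eqxx (negbTE jb) eqxx /eta {th eta}.
move: (N0 b) (N0 j) (hc j jb) (hb j jb) mj.
move: (N b) (N j) (tnth mu b) (tnth mu j) (tnth (scheduled_means a x) b)
  (tnth (scheduled_means a x) j).
move=> nb nj mb mj' xb' xj nb0 nj0 hcc hD mj.
set V := nb^-1 + nj^-1 in hcc *.
have V0 : 0 < V by rewrite addr_gt0// invr_gt0.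
(* The first term is nonnegative because [j] beats [b] empirically; the second is the Chernoff
   exponent, at least [c] by hypothesis. *)
have -> : nb * (- ((mb - mj') / V / nb) * (xb' - mb) -
    (- ((mb - mj') / V / nb)) ^+ 2 / 2) +
  nj * ((mb - mj') / V / nj * (xj - mj') - ((mb - mj') / V / nj) ^+ 2 / 2) =
  (mb - mj') / V * (xj - xb') + (mb - mj') ^+ 2 / (2 * V).
  have nbn : nb != 0 by rewrite gt_eqF.
  have njn : nj != 0 by rewrite gt_eqF.
  have Vn : nj + nb != 0 by rewrite gt_eqF// addr_gt0.
  by rewrite /V; field; rewrite nbn njn Vn.
rewrite -[leLHS]add0r lerD//.
  by rewrite mulr_ge0// ?subr_ge0// divr_ge0 ?ltW// subr_gt0.
by rewrite ler_pdivlMr ?mulr_gt0//; apply: le_trans hcc; rewrite mulrCA mulrA.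
Qed.

End static_error.

(** * Limits superior and hardness *)

Section limits.
Context {R : realType}.

Lemma near_ge_mulS (M c : R) : 0 < c -> \forall n \near \oo, M <= n.+1%:R * c.
Proof.
move=> c0; near=> n; rewrite -ler_pdivrMr//.
by apply: (@le_trans _ _ n%:R); [near: n; exact: nbhs_infty_ger|rewrite ler_nat].
Unshelve. all: by end_near. Qed.

Lemma limn_esup_le_near (u : (\bar R)^nat) l :
  (\forall n \near \oo, u n <= l)%E -> (limn_esup u <= l)%E.
Proof.
move=> ul; apply: (@le_trans _ _ (ereal_sup (u @` [set n | (u n <= l)%E]))).
  by apply: ereal_inf_lbound; exists [set n | (u n <= l)%E].
by apply: ge_ereal_sup => _ [n /= unl <-].
Qed.

Lemma limn_esup_lt_near (u : (\bar R)^nat) l :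
  (limn_esup u < l)%E -> \forall n \near \oo, (u n < l)%E.
Proof.
move=> /ereal_inf_lt[_ [V VF <-] Vl]; apply: filterS VF => n Vn.
by apply: le_lt_trans Vl; apply: ereal_sup_ubound; exists n.
Qed.

End limits.

Section hardness.
Context {R : realType} {K : nat}.
Variable istar : K.-tuple R -> 'I_K.

Lemma measurable_error T (A : algorithm R K T) k :
  measurable [set x | answer A x <> k].
Proof.
rewrite (_ : [set x | _] = ~` (answer A @^-1` [set k])); last by apply/seteqP; split.
by apply: measurableC; exact: measurable_answer.
Qed.

Lemma error_prob_ge0 mu T (A : algorithm R K T) : 0 <= error_prob istar mu A.
Proof. exact: fine_ge0. Qed.

Lemma error_prob_le1 mu T (A : algorithm R K T) : error_prob istar mu A <= 1.
Proof.
rewrite -lee_fin fineK ?fin_num_measure//; last exact: measurable_error.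
by apply: probability_le1; exact: measurable_error.
Qed.

(** A positive horizon makes the bound on the error strictly less than 1, which excludes the case of
    infinite hardness. *)
Lemma hardness_le mu T (A : algorithm R K T.+1) U : 0 < U ->
  error_prob istar mu A <= expR (- (T.+1%:R / U)) ->
  (hardness istar mu A <= U%:E)%E.
Proof.
move=> U0 pU; rewrite /hardness; have [_|p0] := eqVneq; first by rewrite lee_fin ltW.
have TU0 : 0 < T.+1%:R / U by rewrite divr_gt0.
have p_gt0 : 0 < error_prob istar mu A by rewrite lt0r p0 error_prob_ge0.
have [p1|_] := eqVneq.
  by move: pU; rewrite p1 leNgt expR_lt1 oppr_lt0 TU0.
have lnU : T.+1%:R / U <= ln (error_prob istar mu A)^-1.
  by rewrite lnV ?posrE// lerNr -[leRHS]expRK ler_ln ?posrE ?expR_gt0.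
rewrite lee_fin ler_pdivrMr; last exact: lt_le_trans lnU.
by rewrite mulrC -ler_pdivrMr.
Qed.

Lemma hardness_lt mu T (A : algorithm R K T.+1) U : 0 < U ->
  (hardness istar mu A < U%:E)%E ->
  error_prob istar mu A < expR (- (T.+1%:R / U)).
Proof.
move=> U0; rewrite /hardness; have [->|p0] := eqVneq; first by rewrite expR_gt0.
have [//|p1] := eqVneq.
have p_gt0 : 0 < error_prob istar mu A by rewrite lt0r p0 error_prob_ge0.
have p_lt1 : error_prob istar mu A < 1 by rewrite lt_neqAle p1 error_prob_le1.
have ln0 : 0 < ln (error_prob istar mu A)^-1 by rewrite ln_gt0// invf_gt1.
rewrite lte_fin ltr_pdivrMr// mulrC -ltr_pdivrMr// => h.
by rewrite -ltr_ln ?posrE ?expR_gt0// expRK ltrNr -lnV ?posrE.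
Qed.

Lemma hardness_ge0 mu T (A : algorithm R K T) : (0 <= hardness istar mu A)%E.
Proof.
rewrite /hardness; have [//|p0] := eqVneq; have [//|p1] := eqVneq.
have p_gt0 : 0 < error_prob istar mu A by rewrite lt0r p0 error_prob_ge0.
by rewrite lee_fin divr_ge0// ln_ge0// invf_ge1// error_prob_le1.
Qed.

Lemma oracle_difficulty_ge0 C mu : (0 <= oracle_difficulty istar C mu)%E.
Proof.
apply: le_ereal_inf_tmp => _ [A _ <-]; apply: limf_esup_ge0; last first.
  by move=> n; exact: hardness_ge0.
by move=> /filter_not_empty.
Qed.

End hardness.

(** * Upper bound on the oracle difficulty *)

Section oracle_difficulty_upper_bound.
Context {R : realType} {K : nat}.
Variables (istar : K.-tuple R -> 'I_K) (istarP : best_arm_map istar).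
Variables (C : set (algorithm_family R K)) (spC : static_proportions istar `<=` C).

(** Static proportions [w] have error exponent at least [G] per round, up to the rounding of the
    allocation and the factor [K] of the union bound. Both vanish in the limit, at the price of the
    slack [e]. *)
Lemma oracle_difficulty_le (mu : K.-tuple R) b (w : 'I_K -> R) G :
  (forall j, j != b -> tnth mu j < tnth mu b) -> open_simplex w -> 0 < G ->
  (forall j, j != b ->
    2 * G * ((w b)^-1 + (w j)^-1) <= (tnth mu b - tnth mu j) ^+ 2) ->
  (oracle_difficulty istar C mu <= G^-1%:E)%E.
Proof.
move=> hb hw G0 hG; apply/lee_addgt0Pr => e e0; rewrite -EFinD.
set U := G^-1 + e.
have U0 : 0 < U by rewrite addr_gt0// invr_gt0.
have GU : 1 < G * U by rewrite /U mulrDr divff ?gt_eqF// ltrDl mulr_gt0.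
(* Midway between 1 and [G * U]: [rho > 1] leaves room for the rounding error in [nN], and
   [rho < G * U] for the factor [K] in [nK]. *)
pose rho := (1 + G * U) / 2.
have rho1 : 1 < rho by rewrite /rho; lra.
have rho0 : 0 < rho by exact: lt_trans rho1.
have [a ha] := choice (fun T => @allocation_exists R K w T hw).
pose A n := @static_algorithm R K n.+1 istar istarP (a n.+1).
have AC : C A.
  apply: spC; exists w => // n x; split=> // k.
  by rewrite pulls_nonadaptive; exact: ha.
apply: (@le_trans _ _ (limn_esup (fun n => hardness istar mu (A n)))).
  by apply: ereal_inf_lbound; exists A.
apply: limn_esup_le_near.
have nN : \forall n \near \oo, forall k,
    n.+1%:R * w k <= rho * @scheduled_pulls R K n.+1 (a n.+1) k.
  apply: filter_forall => k; have wk0 := hw.1 k.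
  have c0 : 0 < w k * (1 - rho^-1) by rewrite mulr_gt0// subr_gt0 invf_lt1.
  near=> n.
  have : K%:R <= n.+1%:R * (w k * (1 - rho^-1)) by near: n; exact: near_ge_mulS.
  have := ha n.+1 k; rewrite -/(scheduled_pulls _ _) ler_norml => /andP[h _] h'.
  by rewrite -ler_pdivrMl//; lra.
have nK : \forall n \near \oo, ln K%:R <= n.+1%:R * (G / rho - U^-1).
  apply: near_ge_mulS; rewrite subr_gt0 ltr_pdivlMr// mulrC -ltr_pdivlMr ?invr_gt0//.
  by rewrite invrK /rho; lra.
near=> n; apply: hardness_le => //.
have nNn : forall k, n.+1%:R * w k <= rho * @scheduled_pulls R K n.+1 (a n.+1) k.
  by near: n.
have nKn : ln K%:R <= n.+1%:R * (G / rho - U^-1) by near: n.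
have N0 k : 0 < @scheduled_pulls R K n.+1 (a n.+1) k.
  rewrite -(pmulr_rgt0 _ rho0); apply: lt_le_trans (nNn k).
  by rewrite mulr_gt0//; exact: hw.1.
apply: (le_trans (@static_error_le R K n.+1 istar istarP (a n.+1) mu b
  (n.+1%:R * (G / rho)) hb N0 _)).
  move=> j jb; apply: le_trans (hG j jb).
  have iN k : n.+1%:R / rho / @scheduled_pulls R K n.+1 (a n.+1) k <= (w k)^-1.
    rewrite !ler_pdivrMr// -(ler_pM2r (hw.1 k)); apply: le_trans (nNn k) _.
    rewrite le_eqVlt; apply/orP; left; apply/eqP; field.
    by rewrite gt_eqF//; exact: hw.1.
  have := iN b; have := iN j.
  move: (scheduled_pulls (a n.+1) j)^-1 (scheduled_pulls (a n.+1) b)^-1 => x y hx hy.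
  have -> : 2 * (n.+1%:R * (G / rho)) * (y + x) =
      2 * G * (n.+1%:R / rho * y + n.+1%:R / rho * x) by ring.
  by rewrite ler_pM2l ?lerD// mulr_gt0.
have K0 : 0 < K%:R :> R by rewrite ltr0n (leq_ltn_trans _ (ltn_ord b)).
rewrite -[K%:R]lnK ?posrE// -expRD ler_expR.
lra.
Unshelve. all: by end_near. Qed.

End oracle_difficulty_upper_bound.

(** * Hard instances *)

Section consequences_of_small_ratio.
Context {R : realType} {K : nat}.
Variables (istar : K.-tuple R -> 'I_K).
Variables (C : set (algorithm_family R K)) (A : algorithm_family R K).

Lemma error_prob_of_limit_difficulty_ratio (mu : K.-tuple R) (G c : R) :
  0 < G -> 0 < c -> (oracle_difficulty istar C mu <= G^-1%:E)%E ->
  (limit_difficulty_ratio istar (oracle_difficulty istar C) A mu < c%:E)%E ->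
  \forall n \near \oo,
    error_prob istar mu (A n) < expR (- (n.+1%:R * (G / c))).
Proof.
move=> G0 c0; have := oracle_difficulty_ge0 istar C mu.
rewrite /limit_difficulty_ratio /difficulty_ratio.
case: (oracle_difficulty istar C mu) => [h| |]//.
rewrite !lee_fin => h0 hG /limn_esup_lt_near.
(* A zero oracle difficulty makes the ratio infinite by convention, contradicting the bound [c]. *)
have [->|hn0] := eqVneq h 0.
  by rewrite eqxx; apply: filterS => n /=; rewrite ltNge leey.
have h_gt0 : 0 < h by rewrite lt0r hn0.
have h0E : (h%:E == 0)%E = false by rewrite eqe; apply/negbTE.
rewrite h0E inver (negbTE hn0); apply: filterS => n.
rewrite lte_pdivrMr// -EFinM => hlt.
have -> : n.+1%:R * (G / c) = n.+1%:R / (c / G) by rewrite invf_div.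
apply: hardness_lt; first by rewrite divr_gt0.
by apply: lt_le_trans hlt _; rewrite lee_fin ler_wpM2l// ltW.
Qed.

End consequences_of_small_ratio.

(** By induction, as [ln (1 + 1/(n+1)) <= 1/(n+1) <= 3/(n+3)]; the last inequality is an equality at
    [n = 0], whence the factor 3. *)
Lemma ln_le_harmonic (R : realType) n :
  ln n.+1%:R <= 3 * \sum_(1 <= i < n.+1) (i%:R + 2)^-1 :> R.
Proof.
elim: n => [|n IH]; first by rewrite big_geq// ln1 mulr0.
rewrite big_nat_recr//= mulrDr.
have -> : n.+2%:R = n.+1%:R * (1 + n.+1%:R^-1) :> R.
  by rewrite mulrDr mulr1 divff// natr1.
rewrite lnM ?posrE ?addr_gt0//; apply: lerD => //.
apply: (@le_trans _ _ n.+1%:R^-1).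
  by apply: le_ln1Dx; apply: lt_trans (ltrN10 R) _; rewrite invr_gt0.
rewrite ler_pdivlMr ?addr_gt0// ler_pdivrMl//.
have : 1 <= n.+1%:R :> R by rewrite ler1n.
lra.
Qed.

Section hard_instances.
Context {R : realType} {K : nat}.
Hypothesis K_ge2 : (2 <= K)%N.
Implicit Types i j k : 'I_K.

Let K0 : (0 < K)%N. Proof. exact: ltnW. Qed.
Let k0 : 'I_K := Ordinal K0.
Let kappa : R := K%:R.
Let kappa_ge1 : 1 <= kappa. Proof. by rewrite ler1n. Qed.
Let kappa_gt0 : 0 < kappa. Proof. by rewrite ltr0n. Qed.

Definition base_problem : K.-tuple R :=
  [tuple if val k == 0 then 0 else - K%:R ^+ k | k < K].

(** Written as a shift of one arm so that [change_of_arm_lower_bound] applies directly; it is a sign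
    flip for [i > 0]. *)
Definition flipped_problem i : K.-tuple R :=
  shift_means base_problem (fun k => if k == i then 2 * K%:R ^+ i else 0).

Let flipped_same i : val i != 0 -> tnth (flipped_problem i) i = kappa ^+ i.
Proof. by move=> i0; rewrite !tnth_mktuple eqxx (negbTE i0) -/kappa; ring. Qed.

Let flipped_other i k : k != i -> tnth (flipped_problem i) k =
  if val k == 0 then 0 else - kappa ^+ k.
Proof. by move=> ki; rewrite !tnth_mktuple (negbTE ki) addr0. Qed.

Lemma base_problem_best j : j != k0 -> tnth base_problem j < tnth base_problem k0.
Proof.
move=> j0; rewrite !tnth_mktuple/= ifN//.
by rewrite oppr_lt0 exprn_gt0.
Qed.

Lemma flipped_problem_best i : val i != 0 ->
  forall j, j != i -> tnth (flipped_problem i) j < tnth (flipped_problem i) i.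
Proof.
move=> i0 j ji; rewrite flipped_same// flipped_other//.
have Di : 0 < kappa ^+ i by rewrite exprn_gt0.
have Dj : 0 < kappa ^+ j by rewrite exprn_gt0.
by case: ifP => _ //; rewrite (lt_trans _ Di)// oppr_lt0.
Qed.

Variables (istar : K.-tuple R -> 'I_K) (istarP : best_arm_map istar).
Variables (C : set (algorithm_family R K)) (spC : static_proportions istar `<=` C).

(** Uniform proportions, with all gaps at least 1. What matters later is that the bound is finite: a
    finite ratio then drives the error on the base problem to 0. *)
Lemma oracle_difficulty_base :
  (oracle_difficulty istar C base_problem <= (4 * K%:R)%:E)%E.
Proof.
rewrite -[4 * K%:R]invrK.
apply: (@oracle_difficulty_le _ _ _ istarP _ spC _ k0 (fun=> kappa^-1)) => //.
- exact: base_problem_best.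
- split=> [k|]; first by rewrite invr_gt0.
  by rewrite sumr_const card_ord -(mulr_natl _ K) divff// gt_eqF.
- by rewrite invr_gt0 mulr_gt0.
move=> j j0; rewrite !tnth_mktuple/= ifN// sub0r opprK invrK.
have -> : 2 * (4 * K%:R)^-1 * (kappa + kappa) = 1 :> R.
  by rewrite /kappa; field; rewrite gt_eqF.
by rewrite -exprM exprn_ege1.
Qed.

Lemma oracle_difficulty_flipped i : val i != 0 ->
  (oracle_difficulty istar C (flipped_problem i) <=
    ((K%:R ^+ i) ^+ 2 / (4 * (i%:R + 2)))^-1%:E)%E.
Proof.
move=> i0; rewrite -/kappa.
(* The half of the budget not spent on arm [i] is shared in proportion to [rho]. The arms above [i]
   together count for at most one arm, hence [W <= i + 1]. *)
pose rho k : R := if (k < i)%N then 1 else kappa^-1.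
pose W : R := \sum_(k | k != i) rho k.
have rho0 k : 0 < rho k by rewrite /rho; case: ifP; rewrite ?invr_gt0.
have ik0 : k0 != i by apply: contra_neq i0 => <-.
have W1 : 1 <= W.
  rewrite /W (bigD1 k0)//= {1}/rho lt0n i0 -[leLHS]addr0 lerD// sumr_ge0// => k _.
  exact: ltW.
have W0 : 0 < W by exact: lt_le_trans W1.
have Wi : W <= i%:R + 1.
  apply: (@le_trans _ _ (\sum_(k < K) ((k < i)%N%:R + kappa^-1))).
    rewrite /W [leRHS](bigD1 i)//= -[leLHS]add0r; apply: lerD.
      by rewrite addr_ge0// invr_ge0 ltW.
    apply: ler_sum => k _; rewrite /rho; case: ifP => _; last by rewrite add0r.
    by rewrite lerDl invr_ge0 ltW.
  rewrite big_split/= sumr_const card_ord -(mulr_natl _ K) divff ?gt_eqF// lerD2r.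
  rewrite -natr_sum ler_nat -[leqRHS](card_ord i) -sum1_card.
  rewrite (big_ord_widen K (fun=> 1%N) (ltnW (ltn_ord i))) [leqRHS]big_mkcond.
  by apply: leq_sum => k _; case: ifP.
pose w k : R := if k == i then 2^-1 else rho k / (2 * W).
have Di0 : 0 < kappa ^+ i by rewrite exprn_gt0.
have i20 : 0 < i%:R + 2 :> R by rewrite ltr_wpDl.
apply: (@oracle_difficulty_le _ _ _ istarP _ spC _ i w).
- exact: flipped_problem_best.
- split=> [k|]; rewrite /w.
    by case: ifP => _; rewrite ?invr_gt0// divr_gt0// mulr_gt0.
  rewrite (bigD1 i)//= eqxx (eq_bigr (fun k => rho k / (2 * W))).
    by rewrite -mulr_suml -/W; field; rewrite gt_eqF.
  by move=> k /negbTE ->.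
- by rewrite divr_gt0 ?exprn_gt0// mulr_gt0.
move=> j ji; rewrite flipped_same// flipped_other// /w eqxx (negbTE ji) invrK.
rewrite invf_div.
have -> : 2 * ((kappa ^+ i) ^+ 2 / (4 * (i%:R + 2))) * (2 + 2 * W / rho j) =
    (kappa ^+ i) ^+ 2 * ((1 + W / rho j) / (i%:R + 2)).
  by field; rewrite !gt_eqF.
have sqr_le (x y : R) : 0 <= x -> x <= y -> x ^+ 2 <= y ^+ 2.
  by move=> x0 xy; rewrite ler_sqr ?nnegrE// (le_trans x0).
have D0 (k : nat) : 0 <= kappa ^+ k by rewrite exprn_ge0// ltW.
have [jlti|jgei] := ltnP j i.
  rewrite /rho jlti divr1.
  apply: (@le_trans _ _ ((kappa ^+ i) ^+ 2)).
    rewrite ler_piMr ?sqr_ge0// ler_pdivrMr//; lra.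
  apply: sqr_le => //; case: ifP => _; first by rewrite subr0.
  by rewrite opprK lerDl.
have ij : (i < j)%N by rewrite ltn_neqAle jgei andbT eq_sym.
rewrite ifN; last by rewrite -lt0n (leq_ltn_trans _ ij).
rewrite /rho ltnNge jgei/= invrK opprK.
(* For [j > i] the squared gap is at least [K ^ 2] times that of level [i], which outweighs the
   factor [K] lost through the small weight. *)
apply: (@le_trans _ _ ((kappa ^+ j) ^+ 2)); last first.
  by apply: sqr_le => //; rewrite lerDr.
apply: (@le_trans _ _ ((kappa * kappa ^+ i) ^+ 2)); last first.
  by rewrite -exprS; apply: sqr_le => //; exact: (ler_weXn2l kappa_ge1).
rewrite exprMn [leRHS]mulrC ler_wpM2l ?sqr_ge0// ler_pdivrMr//.
have h1 : W * kappa <= (i%:R + 1) * kappa by rewrite ler_wpM2r// ltW.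
have h2 : (i%:R + 1) * kappa + 1 <= kappa * (i%:R + 2).
  by have := kappa_ge1; lra.
have h3 : kappa * (i%:R + 2) <= kappa ^+ 2 * (i%:R + 2).
  by rewrite ler_wpM2r ?(ltW i20)// expr2 ler_peMl// ltW.
by apply: le_trans h3; apply: le_trans h2; rewrite addrC lerD2r.
Qed.

End hard_instances.

(** * Pulls forced by accuracy, and conclusion *)

Lemma expected_pulls_ge (R : realType) (K T : nat) (K_ge2 : (2 <= K)%N)
    (istar : K.-tuple R -> 'I_K) (istarP : best_arm_map istar)
    (A : algorithm R K T) (i : 'I_K) (z : R) :
  val i != 0 -> 0 <= z ->
  error_prob istar base_problem A <= 1 / 100 ->
  error_prob istar (flipped_problem i) A < expR (- z) ->
  (99 / 100 * z - 21 / 100) / (21 / 10 * (K%:R ^+ i) ^+ 2) <=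
    expected_pulls A base_problem i.
Proof.
move=> i0 z0 pbase pflip; pose D : R := K%:R ^+ i.
have D0 : 0 < D by rewrite exprn_gt0// ltr0n (ltn_trans _ K_ge2).
(* Nearly certain on the base problem, where answering [i] is an error, and of probability below
   [expR (- z)] on the flipped one. *)
pose E := [set x | answer A x <> i].
have mE : measurable E by exact: measurable_error.
have ib : istar base_problem != i.
  rewrite (best_arm_map_eq istarP (@base_problem_best R K K_ge2)).
  by apply: contra_neq i0 => <-.
have iflip : istar (flipped_problem i) = i.
  exact: best_arm_map_eq (flipped_problem_best K_ge2 i0).
have q : 99 / 100 <= fine (obs_law base_problem A T E).
  apply: (@le_trans _ _ (1 - error_prob istar base_problem A)); first lra.
  rewrite lerBlDr -lee_fin EFinD !fineK ?fin_num_measure//; last exact: measurable_error.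
  rewrite -[X in (X <= _)%E](obs_law_setT A base_problem T).
  apply: le_trans (measureU2 _ mE (measurable_error A _)).
  apply: le_measure; rewrite ?inE//; first exact: measurableU (measurable_error A _).
  move=> x _; have [xi|] := eqVneq (answer A x) i; [right|by left; apply/eqP].
  by rewrite /= xi => /esym/eqP; rewrite (negbTE ib).
(* With [s = 1/20] the coefficient of the pulls is [(1 + s) / 2 * 4 D^2 = 21/10 D^2], close to its
   limit [2 D^2]. The constants [1 + 1/s = 21] on both sides cancel up to
   [21 * (1 - 99/100) = 21/100]. *)
have := change_of_arm_lower_bound A base_problem i (2 * D) mE
  (ltac:(lra) : 0 < 1 / 20 :> R) z0.
rewrite -/(flipped_problem i).
have p1 : expR z * fine (obs_law (flipped_problem i) A T E) <= 1.
  rewrite mulrC -ler_pdivlMr ?expR_gt0// mul1r -expRN.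
  by move: pflip; rewrite /error_prob iflip => /ltW.
have qz : (1 + z + (1 / 20)^-1) * (99 / 100) <=
    (1 + z + (1 / 20)^-1) * fine (obs_law base_problem A T E).
  by rewrite ler_wpM2l//; lra.
move=> h; rewrite -/D ler_pdivrMr; last by rewrite mulr_gt0// exprn_gt0.
move: h p1 qz; rewrite exprMn.
move: (fine _) (expected_pulls _ _ _) (expR z * _) (D ^+ 2) => x y u d.
lra.
Qed.

Theorem theorem8 (R : realType) (K : nat) (K_ge2 : (2 <= K)%N)
    (istar : K.-tuple R -> 'I_K) (istarP : best_arm_map istar)
    (C : set (algorithm_family R K)) (spC : static_proportions istar `<=` C) :
  ((3 / 80 * ln K%:R)%:E <=
    ereal_inf [set ereal_sup
        [set limit_difficulty_ratio istar (oracle_difficulty istar C) A lambda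
          | lambda in unique_best_arm R K]
      | A in [set: algorithm_family R K]])%E.
Proof.
apply: le_ereal_inf_tmp => _ [A _ <-]; rewrite leNgt; apply/negP => hsup.
have hlim lambda : unique_best_arm R K lambda ->
    (limit_difficulty_ratio istar (oracle_difficulty istar C) A lambda <
     (3 / 80 * ln K%:R)%:E)%E.
  by move=> hl; apply: le_lt_trans hsup; apply: ereal_sup_ubound; exists lambda.
have lnK0 : 0 < ln K%:R :> R by rewrite ln_gt0// ltr1n.
set c : R := 3 / 80 * ln K%:R in hlim.
have c0 : 0 < c by rewrite mulr_gt0.
have K0 : 0 < K%:R :> R by rewrite ltr0n (ltn_trans _ K_ge2).
have base : \forall n \near \oo, error_prob istar base_problem (A n) <= 1 / 100.
  have := error_prob_of_limit_difficulty_ratio (G := (4 * K%:R)^-1) _ c0 _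
    (hlim _ (ex_intro _ _ (@base_problem_best R K K_ge2))).
  rewrite invrK invr_gt0 mulr_gt0// => /(_ isT (oracle_difficulty_base K_ge2 istarP spC)).
  have /(near_ge_mulS (ln 100)) : 0 < (4 * K%:R)^-1 / c.
    by rewrite divr_gt0// invr_gt0 mulr_gt0.
  apply: filterS2 => n hn /ltW; move/le_trans; apply.
  by rewrite expRN div1r lef_pV2 ?posrE ?expR_gt0// -[leLHS]lnK ?posrE// ler_expR.
pose G (i : 'I_K) : R := (K%:R ^+ i) ^+ 2 / (4 * (i%:R + 2)).
have i2 (i : 'I_K) : 0 < i%:R + 2 :> R by rewrite ltr_wpDl.
have G0 i : 0 < G i by rewrite divr_gt0 ?exprn_gt0// mulr_gt0.
have flip : \forall n \near \oo, forall i : 'I_K, val i != 0 ->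
    error_prob istar (flipped_problem i) (A n) < expR (- (n.+1%:R * (G i / c))).
  apply: filter_forall => i; have [i0|i0] := eqVneq (val i) 0%N.
    by apply: nearW => n /eqP.
  have := error_prob_of_limit_difficulty_ratio (G0 i) c0
    (oracle_difficulty_flipped K_ge2 istarP spC i0)
    (hlim _ (ex_intro _ _ (flipped_problem_best K_ge2 i0))).
  by apply: filterS => n.
have large : \forall n \near \oo, 3 * K%:R <= n.+1%:R * 1 :> R by exact: near_ge_mulS.
have [n [[hb hf] hn]] := filter_ex (filterI (filterI base flip) large).
(* The factor [99/840] is [99/100] divided by [4 * 21/10]. The power of [K] cancels in the main
   term, and the loss [21/100 / (21/10) = 1/10] is only divided by a number at least 1. *)
have pulls_ge (i : 'I_K) : val i != 0 ->
    n.+1%:R / c * (99 / 840) * (i%:R + 2)^-1 - 1 / 10 <=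
    expected_pulls (A n) base_problem i.
  move=> i0; apply: le_trans (expected_pulls_ge K_ge2 istarP i0 _ hb (hf i i0)).
    have Di1 : 1 <= (K%:R ^+ i) ^+ 2 :> R.
      by rewrite !exprn_ege1// ler1n (ltn_trans _ K_ge2).
    rewrite /G; move: (K%:R ^+ i ^+ 2) Di1 => d d1.
    have d0 : 0 < d by exact: lt_le_trans d1.
    have -> : (99 / 100 * (n.+1%:R * (d / (4 * (i%:R + 2)) / c)) - 21 / 100) /
        (21 / 10 * d) = n.+1%:R / c * (99 / 840) * (i%:R + 2)^-1 - 1 / 10 * d^-1.
      by field; rewrite !gt_eqF.
    by rewrite lerD2l lerN2 ler_piMr// invf_le1.
  by rewrite mulr_ge0// divr_ge0// ltW.
have sum_ge : n.+1%:R / c * (99 / 840) * \sum_(1 <= i < K) (i%:R + 2)^-1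
    - K%:R / 10 <= n.+1%:R.
  have -> : \sum_(1 <= i < K) (i%:R + 2)^-1 =
      \sum_(i < K | val i != 0) (i%:R + 2)^-1 :> R.
    rewrite -(big_mkord (fun i => i != 0)%N (fun i => (i%:R + 2)^-1 : R)).
    rewrite [RHS]big_ltn_cond ?(ltn_trans _ K_ge2)//= [LHS]big_nat_cond.
    by rewrite [RHS]big_nat_cond; apply: eq_bigl => -[|j]; rewrite /= ?andbT.
  rewrite -[leRHS](sum_expected_pulls (A n) base_problem) mulr_sumr.
  have -> : K%:R / 10 = \sum_(i < K) 1 / 10 :> R.
    by rewrite sumr_const card_ord -[RHS]mulr_natl div1r.
  rewrite [X in X - _]big_mkcond -sumrB; apply: ler_sum => i _.
  case: ifP => i0; first exact: pulls_ge.
  by apply: le_trans (expected_pulls_ge0 _ _ _); rewrite sub0r oppr_le0 divr_ge0.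
have := ln_le_harmonic R K.-1; rewrite prednK ?(ltn_trans _ K_ge2)// => hS.
(* Here [3/80] enters: [80/9 * 99/840 = 22/21] exceeds 1, so the forced pulls exceed the horizon by
   a 21st of it, minus [K/10]. The condition [large] makes this excess positive. *)
have cS : 80 / 9 <= c^-1 * \sum_(1 <= i < K) (i%:R + 2)^-1.
  by rewrite ler_pdivlMl// /c; lra.
have : n.+1%:R * (80 / 9) <= n.+1%:R * (c^-1 * \sum_(1 <= i < K) (i%:R + 2)^-1).
  by rewrite ler_wpM2l.
have : 0 < n.+1%:R :> R by rewrite ltr0n.
move: sum_ge hn; move: n.+1%:R K%:R c^-1 (\sum_(1 <= i < K) _) => N k d S.
lra.
Qed.
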